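(* Let $a<b$ be real numbers. An element $f\in C[a,b]$ is a zero divisor of the ring $C[a,b]$ if and only if the zero set $Z_f=\{x\in[a,b] : f(x)=0\}$ of $f$ contains a non-empty open interval.
   Context: $C[a,b]$ denotes the Banach algebra of all continuous complex-valued functions on the closed interval $[a,b]$, with pointwise operations and the supremum norm. An element $z$ of a ring $R$ is called a zero divisor if either $zx=0$ for some non-zero $x\in R$ or $yz=0$ for some non-zero $y\in R$; in particular, in a non-zero ring the element $0$ counts as a zero divisor. A non-empty open interval is a set $(c,d)$ with real $c<d$. *)

(* Defs.v *)
From HB Require Import structures.
From mathcomp Require Import all_boot all_order all_algebra.
From mathcomp Require Import complex.
From mathcomp Require Import all_classical all_reals all_analysis.

Set Implicit Arguments.
Unset Strict Implicit.
Unset Printing Implicit Defensive.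

Import Order.TTheory GRing.Theory Num.Theory.
Import numFieldNormedType.Exports.

Local Open Scope classical_set_scope.
Local Open Scope ring_scope.

(* [x != 0] is required of the cofactor only, so [0] is a zero divisor of every
   nontrivial ring. *)
Definition zero_divisor (A : pzRingType) (z : A) : Prop :=
  (exists x : A, x != 0 /\ z * x = 0) \/ (exists y : A, y != 0 /\ y * z = 0).

Section ContinuousRing.
Variables (X : topologicalType) (K : numFieldType).
Implicit Types f g h : continuousType X K^o.

Lemma cts_zero_subproof : continuous (0 : X -> K^o).
Proof. by move=> x; exact: cvg_cst. Qed.

Lemma cts_one_subproof : continuous (1 : X -> K^o).
Proof. by move=> x; exact: cvg_cst. Qed.

Lemma cts_opp_subproof f : continuous (- (f : X -> K^o)).
Proof. by move=> x; apply: cvgN; exact: cts_fun. Qed.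

Lemma cts_add_subproof f g : continuous ((f : X -> K^o) + (g : X -> K^o)).
Proof. by move=> x; apply: cvgD; exact: cts_fun. Qed.

Lemma cts_mul_subproof f g : continuous ((f : X -> K^o) * (g : X -> K^o)).
Proof. by move=> x; apply: (@cvgM K); exact: cts_fun. Qed.

Definition cts_zero : continuousType X K^o := mkcts cts_zero_subproof.
Definition cts_one : continuousType X K^o := mkcts cts_one_subproof.
Definition cts_opp f : continuousType X K^o := mkcts (@cts_opp_subproof f).
Definition cts_add f g : continuousType X K^o := mkcts (@cts_add_subproof f g).
Definition cts_mul f g : continuousType X K^o := mkcts (@cts_mul_subproof f g).

Lemma cts_addA : associative cts_add.
Proof. by move=> f g h; apply/continuousEP => x; exact: addrA. Qed.

Lemma cts_addC : commutative cts_add.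
Proof. by move=> f g; apply/continuousEP => x; exact: addrC. Qed.

Lemma cts_add0 : left_id cts_zero cts_add.
Proof. by move=> f; apply/continuousEP => x; exact: add0r. Qed.

Lemma cts_addN : left_inverse cts_zero cts_opp cts_add.
Proof. by move=> f; apply/continuousEP => x; exact: addNr. Qed.

HB.instance Definition _ := GRing.isZmodule.Build (continuousType X K^o)
  cts_addA cts_addC cts_add0 cts_addN.

Lemma cts_mulA : associative cts_mul.
Proof. by move=> f g h; apply/continuousEP => x; exact: mulrA. Qed.

Lemma cts_mulC : commutative cts_mul.
Proof. by move=> f g; apply/continuousEP => x; exact: mulrC. Qed.

Lemma cts_mul1 : left_id cts_one cts_mul.
Proof. by move=> f; apply/continuousEP => x; exact: mul1r. Qed.

Lemma cts_mulDl : left_distributive cts_mul cts_add.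
Proof. by move=> f g h; apply/continuousEP => x; exact: mulrDl. Qed.

HB.instance Definition _ := GRing.Zmodule_isComPzRing.Build
  (continuousType X K^o) cts_mulA cts_mulC cts_mul1 cts_mulDl.

End ContinuousRing.

(* The interval is a [set_type] with the topology induced from [R]; [R[i]^o]
   has the topology of the modulus. The supremum norm is omitted, as it is not
   part of the ring structure. *)
Definition Cab (R : realType) (a b : R) : comPzRingType :=
  continuousType (set_type `[a, b]%classic) (R[i])^o.

Definition Cab_fun (R : realType) (a b : R) (f : Cab a b) :
    set_type `[a, b]%classic -> R[i] :=
  (f : continuousType (set_type `[a, b]%classic) (R[i])^o).

Definition zero_set (R : realType) (a b : R) (f : Cab a b) : set R :=
  set_val @` [set t | Cab_fun f t = 0].

(* Main.v *)
Require Import Defs.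
From mathcomp Require Import all_boot all_order all_algebra.
From mathcomp Require Import complex.
From mathcomp Require Import all_classical all_reals all_analysis.
From mathcomp Require Import lra.

Import Order.TTheory GRing.Theory Num.Theory.
Import numFieldNormedType.Exports.

Local Open Scope classical_set_scope.
Local Open Scope ring_scope.

(** Since [R[i]] has no zero divisors, [f * g = 0] means that at every point
    [f] or [g] vanishes.  If moreover [g] is nonzero at some [t], then by
    continuity it is nonzero on a neighbourhood of [t] in the interval, so [f]
    vanishes there; the neighbourhood contains an open interval even when [t]
    is an endpoint, because [a < b] ([ball_itvcc_open_itv]).  Conversely, if
    [f] vanishes on the open interval with endpoints [c < d], it is annihilated
    by the continuous function [bump c d], whose support is
    [[c, d]]. *)

Lemma continuous_real_complex (R : realType) :
  continuous (fun x : R => (x%:C)%C : R[i]^o).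
Proof.
move=> x; apply/cvgrPdist_lt => e e0.
(* A positive complex number is real, so the radius [e] comes from [R]. *)
have eE : e = ((complex.Re e)%:C)%C by rewrite RRe_real ?gtr0_real.
have re0 : 0 < complex.Re e by rewrite -ltcR -eE.
near=> y.
rewrite /= -rmorphB /= normc_def /= expr0n /= addr0 sqrtr_sqr eE ltcR.
near: y; exact: (@cvgr_dist_lt R R^o _ _ _ id x).
Unshelve. all: by end_near. Qed.

Definition bump {R : realType} (c d : R) : R -> R :=
  fun x => Num.max 0 ((x - c) * (d - x)).

Lemma bump_continuous (R : realType) (c d : R) : continuous (bump c d).
Proof.
move=> x; apply: (@continuous_max R R (cst 0) (fun x => (x - c) * (d - x))).
  exact: cvg_cst.
by apply: (@cvgM R); apply: cvgB; (exact: cvg_cst || exact: cvg_id).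
Qed.

Lemma bump_gt0 (R : realType) (c d x : R) : x \in `]c, d[ -> 0 < bump c d x.
Proof.
by rewrite in_itv /= => /andP[cx xd]; rewrite lt_max mulr_gt0 ?subr_gt0 ?orbT.
Qed.

(** The hypothesis [c < d] excludes the case where [d < x < c], in which the
    quadratic factor would be positive. *)
Lemma bump_eq0 (R : realType) (c d x : R) :
  c < d -> x \notin `]c, d[ -> bump c d x = 0.
Proof.
move=> cd; rewrite in_itv /= negb_and -!leNgt => xcd.
by apply/max_idPl; case/orP: xcd => ?; nra.
Qed.

(** Intersecting the ball with [[a, b]] may cut it at [t], but some room is left
    on one side of [t]. *)
Lemma ball_itvcc_open_itv (R : realType) (a b t e : R) :
    a < b -> t \in `[a, b] -> 0 < e ->
  exists c d : R, c < d /\ `]c, d[ `<=` ball t e `&` `[a, b].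
Proof.
move=> ab; rewrite in_itv /= => /andP[at_ tb] e0.
exists (Num.max a (t - e)), (Num.min b (t + e)); split.
  by rewrite gt_max !lt_min; apply/andP; split; apply/andP; split; lra.
move=> x /=; rewrite in_itv /= gt_max lt_min => /andP[/andP[ax tx] /andP[xb xt]].
split; last by rewrite in_itv /= !ltW.
by rewrite /ball /= ltr_norml; apply/andP; split; lra.
Qed.

Lemma in_zero_set (R : realType) (a b : R) (f : Cab a b)
    (t : set_type `[a, b]) :
  zero_set f (set_val t) <-> Cab_fun f t = 0.
Proof.
split; last by move=> ft0; exists t.
by move=> [u fu0 /val_inj <-].
Qed.

Lemma Cab_neq0 (R : realType) (a b : R) (g : Cab a b) :
  g != 0 <-> exists t, Cab_fun g t != 0.
Proof.
split=> [gneq0|[t]]; last by apply: contra_neq => ->.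
apply: contrapT => /forallNP g0; move/eqP: gneq0; apply.
by apply/continuousEP => t; apply/eqP/negPn/negP; exact: g0.
Qed.

(** The set where [g] is nonzero is open and nonempty, and [f] vanishes on it
    because [R[i]] is a domain. *)
Lemma mul0_zero_set_itv (R : realType) (a b : R) (f g : Cab a b) :
    a < b -> g != 0 -> f * g = 0 ->
  exists c d : R, c < d /\ `]c, d[ `<=` zero_set f.
Proof.
move=> ab /Cab_neq0[t gt] fg0.
have cg : (Cab_fun g : _ -> R[i]^o) u @[u --> t] --> (Cab_fun g t : R[i]^o).
  exact: cts_fun.
have : \forall u \near t, Cab_fun g u != 0.
  exact: (cvgr_neq0 (V := R[i]^o) _ cg gt).
move=> /nbhs_ballP[e /= e0 ge].
have [c [d [cd cdab]]] := ball_itvcc_open_itv _ _ _ _ _ ab (set_valP t) e0.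
exists c, d; split => // x /cdab[xe xab].
pose u : set_type `[a, b] := SigSub (mem_set xab).
apply/(in_zero_set _ _ _ _ u)/eqP.
have : Cab_fun f u * Cab_fun g u == 0.
  by apply/eqP; exact: (congr1 (fun h : Cab a b => Cab_fun h u) fg0).
by rewrite mulf_eq0 (negPf (ge u xe)) orbF.
Qed.

Lemma bump_Cab_continuous (R : realType) (a b c d : R) :
  continuous (fun t : set_type `[a, b] => ((bump c d (set_val t))%:C)%C : R[i]^o).
Proof.
move=> t.
apply: (continuous_comp (f := bump c d \o set_val)).
  apply: continuous_comp; first exact: initial_continuous.
  exact: bump_continuous.
exact: continuous_real_complex.
Qed.

Definition bump_Cab (R : realType) (a b c d : R) : Cab a b :=
  mkcts (bump_Cab_continuous R a b c d).

Theorem theorem2p1 (R : realType) (a b : R) (hab : a < b) (f : Cab a b) :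
  zero_divisor f <-> exists c d : R, c < d /\ `]c, d[%classic `<=` zero_set f.
Proof.
split=> [[[g [g0 fg0]]|[g [g0]]]|[c [d [cd cdf]]]].
- exact: mul0_zero_set_itv fg0.
- by rewrite mulrC; exact: mul0_zero_set_itv.
left; exists (bump_Cab R a b c d); split.
  have mcd : (c + d) / 2 \in `]c, d[ by rewrite in_itv /=; apply/andP; split; lra.
  have [m _ mE] := cdf _ mcd.
  apply/Cab_neq0; exists m.
  change (((bump c d (set_val m))%:C)%C != 0 :> R[i]).
  by rewrite mE fmorph_eq0 gt_eqF// bump_gt0.
apply/continuousEP => t.
have [tcd|tcd] := boolP (set_val t \in `]c, d[).
  have /in_zero_set ft0 := cdf _ tcd.
  by change (Cab_fun f t * Cab_fun (bump_Cab R a b c d) t = 0); rewrite ft0 mul0r.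
change (Cab_fun f t * ((bump c d (set_val t))%:C)%C = 0).
by rewrite bump_eq0// rmorph0 mulr0.
Qed.
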